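(* Let $\rho,\tau,\zeta\in\mathbb R\cup\{\infty\}$ and let $T$ be an oriented non-equilateral triangle. Then the triangle $\mathcal C_\zeta\bigl(\mathcal C_\tau\bigl(\mathcal C_\rho(T)\bigr)\bigr)$ is directly similar to $\mathcal C_{\rho\,\square\,\tau^{\boxminus}\,\square\,\zeta}(T)$, with the ratio of similarity $$\frac{\langle\rho\rangle\,\langle\tau\rangle\,\langle\zeta\rangle}{\langle\rho\,\square\,\tau^{\boxminus}\,\square\,\zeta\rangle}.$$
   Context: An oriented triangle is written as the ordered triple $T=(a,b,c)$ of its side lengths taken counterclockwise (positive reals with $|a-b|<c<a+b$). Oriented triangles $(a,b,c)$, $(x,y,z)$ are directly similar if $\frac ax=\frac by=\frac cz$ or $\frac ay=\frac bz=\frac cx$ or $\frac az=\frac bx=\frac cy$; the common ratio is the ratio of similarity of the first to the second. Ceva's operators: for $\rho\in\mathbb R$, $\mathcal C_\rho(a,b,c)=(x_\rho,y_\rho,z_\rho)$ with $x_\rho=\sqrt{\rho a^2+(1-\rho)b^2+\rho(\rho-1)c^2}$, $y_\rho=\sqrt{(1-\rho)a^2+\rho(\rho-1)b^2+\rho c^2}$, $z_\rho=\sqrt{\rho(\rho-1)a^2+\rho b^2+(1-\rho)c^2}$ (again side lengths of an oriented triangle); $\mathcal C_\infty(a,b,c)=(c,b,a)$. $\langle\rho\rangle=\sqrt{1-\rho+\rho^2}$ for $\rho\in\mathbb R$ and $\langle\infty\rangle=1$. The commutative group operation $\square$ on $\mathbb R\cup\{\infty\}$ (identity $0$): for $\rho,\tau\in\mathbb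 R$, $\rho\,\square\,\tau=\frac{\rho+\tau-\rho\tau}{1-\rho\tau}$ if $\rho\tau\ne1$ and $\rho\,\square\,\tau=\infty$ if $\rho\tau=1$; $\rho\,\square\,\infty=\infty\,\square\,\rho=1-\frac1\rho$ for $\rho\in\mathbb R\setminus\{0\}$; $0\,\square\,\infty=\infty\,\square\,0=\infty$; $\infty\,\square\,\infty=1$. The inverse of $\tau$ is denoted $\tau^{\boxminus}$: $\tau^{\boxminus}=\frac{\tau}{\tau-1}$ for $\tau\in\mathbb R\setminus\{1\}$, $1^{\boxminus}=\infty$, $\infty^{\boxminus}=1$. *)

(* Defs.v *)
From mathcomp Require Import all_boot all_order all_algebra.
From mathcomp Require Import ring lra.
From mathcomp Require Import reals.

Set Implicit Arguments.
Unset Strict Implicit.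
Unset Printing Implicit Defensive.

Import Order.TTheory GRing.Theory Num.Theory.
Local Open Scope ring_scope.

Definition is_triangle (R : realType) (a b c : R) : bool :=
  [&& 0 < a, 0 < b, 0 < c, `|a - b| < c & c < a + b].

(* Side lengths listed counterclockwise: (a, b, c) and (b, a, c) are different
   oriented triangles. *)
Record triangle (R : realType) := Triangle {
  side1 : R;
  side2 : R;
  side3 : R;
  triangleP : is_triangle side1 side2 side3
}.

Definition equilateral (R : realType) (T : triangle R) : Prop :=
  side1 T = side2 T /\ side2 T = side3 T.

Definition directly_similar_with_ratio (R : realType) (T S : triangle R)
    (r : R) : Prop :=
  let: (a, b, c) := (side1 T, side2 T, side3 T) in
  let: (x, y, z) := (side1 S, side2 S, side3 S) in
  [\/ [/\ a / x = r, b / y = r & c / z = r],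
      [/\ a / y = r, b / z = r & c / x = r]
    | [/\ a / z = r, b / x = r & c / y = r]].

Section CevaSquares.
Variables (R : realType) (rho : R).
Implicit Types a b c : R.

Definition ceva_x2 a b c :=
  rho * a ^+ 2 + (1 - rho) * b ^+ 2 + rho * (rho - 1) * c ^+ 2.
Definition ceva_y2 a b c :=
  (1 - rho) * a ^+ 2 + rho * (rho - 1) * b ^+ 2 + rho * c ^+ 2.
Definition ceva_z2 a b c :=
  rho * (rho - 1) * a ^+ 2 + rho * b ^+ 2 + (1 - rho) * c ^+ 2.

(* 16 times the squared area, as a function of the squared sides (Heron). *)
Let heron (X Y Z : R) :=
  2 * (X * Y + Y * Z + Z * X) - X ^+ 2 - Y ^+ 2 - Z ^+ 2.

Let heron_gt0 a b c : is_triangle a b c ->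
  0 < heron (a ^+ 2) (b ^+ 2) (c ^+ 2).
Proof.
case/and5P=> a0 b0 c0; rewrite ltr_norml => /andP[h1 h2] h3.
have -> : heron (a ^+ 2) (b ^+ 2) (c ^+ 2) =
    (a + b + c) * (a + b - c) * (c + a - b) * (c - a + b).
  by rewrite /heron; ring.
by rewrite !mulr_gt0 //; lra.
Qed.

(* Positivity of a quadratic form in rho of negative discriminant. *)
Let quad_gt0 (X Y Z : R) : 0 < Z -> 0 < heron X Y Z ->
  0 < rho * X + (1 - rho) * Y + rho * (rho - 1) * Z.
Proof.
move=> Z0 h; rewrite -(pmulr_rgt0 _ (_ : 0 < 4 * Z)); last by lra.
have -> : 4 * Z * (rho * X + (1 - rho) * Y + rho * (rho - 1) * Z) =
    (2 * Z * rho + X - Y - Z) ^+ 2 + heron X Y Z.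
  by rewrite /heron; ring.
by rewrite ltr_wpDl // sqr_ge0.
Qed.

Let triangle_of_squares (X Y Z : R) : 0 < X -> 0 < Y -> 0 < Z ->
  0 < heron X Y Z -> is_triangle (Num.sqrt X) (Num.sqrt Y) (Num.sqrt Z).
Proof.
move=> X0 Y0 Z0.
rewrite -{1}(sqr_sqrtr (ltW X0)) -{1}(sqr_sqrtr (ltW Y0)).
rewrite -{1}(sqr_sqrtr (ltW Z0)).
move: X0 Y0 Z0; rewrite -(sqrtr_gt0 X) -(sqrtr_gt0 Y) -(sqrtr_gt0 Z).
move: (Num.sqrt X) (Num.sqrt Y) (Num.sqrt Z) => x y z x0 y0 z0.
have -> : heron (x ^+ 2) (y ^+ 2) (z ^+ 2) =
    (z ^+ 2 - (x - y) ^+ 2) * ((x + y) ^+ 2 - z ^+ 2).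
  by rewrite /heron; ring.
have lt_xy : (x - y) ^+ 2 < (x + y) ^+ 2.
  rewrite -subr_gt0.
  have -> : (x + y) ^+ 2 - (x - y) ^+ 2 = 4 * (x * y) by ring.
  by rewrite !mulr_gt0.
move=> h; have [h1 h2] : (x - y) ^+ 2 < z ^+ 2 /\ z ^+ 2 < (x + y) ^+ 2.
  by split; move: h lt_xy; nra.
apply/and5P; split=> //.
  by rewrite -(ltr_pXn2r (n := 2)) ?nnegrE ?normr_ge0 ?ltW // real_normK
    ?num_real.
by rewrite -(ltr_pXn2r (n := 2)) ?nnegrE ?ltW ?addr_gt0.
Qed.

Lemma ceva_is_triangle a b c : is_triangle a b c ->
  is_triangle (Num.sqrt (ceva_x2 a b c)) (Num.sqrt (ceva_y2 a b c))
              (Num.sqrt (ceva_z2 a b c)).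
Proof.
move=> abc; have h := heron_gt0 abc; case/and5P: abc => a0 b0 c0 _ _.
have [a2 b2 c2] : [/\ 0 < a ^+ 2, 0 < b ^+ 2 & 0 < c ^+ 2].
  by split; apply: exprn_gt0.
apply: triangle_of_squares.
- exact: quad_gt0.
- have -> : ceva_y2 a b c = rho * c ^+ 2 + (1 - rho) * a ^+ 2
      + rho * (rho - 1) * b ^+ 2 by rewrite /ceva_y2; ring.
  by apply: quad_gt0 => //; move: h; rewrite /heron; lra.
- have -> : ceva_z2 a b c = rho * b ^+ 2 + (1 - rho) * c ^+ 2
      + rho * (rho - 1) * a ^+ 2 by rewrite /ceva_z2; ring.
  by apply: quad_gt0 => //; move: h; rewrite /heron; lra.
have -> : heron (ceva_x2 a b c) (ceva_y2 a b c) (ceva_z2 a b c) =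
    (1 - rho + rho ^+ 2) ^+ 2 * heron (a ^+ 2) (b ^+ 2) (c ^+ 2).
  by rewrite /heron /ceva_x2 /ceva_y2 /ceva_z2; ring.
by rewrite mulr_gt0 // exprn_gt0 //; nra.
Qed.

End CevaSquares.

Lemma rev_is_triangle (R : realType) (a b c : R) :
  is_triangle a b c -> is_triangle c b a.
Proof.
case/and5P=> a0 b0 c0; rewrite ltr_norml => /andP[h1 h2] h3.
by apply/and5P; split=> //; [rewrite ltr_norml; apply/andP; split|]; lra.
Qed.

(* R extended by a single point at infinity is represented by option R,
   with None as the point at infinity. *)

Definition ceva (R : realType) (rho : option R) (T : triangle R) : triangle R :=
  match rho with
  | Some r => Triangle (ceva_is_triangle r (triangleP T))
  | None => Triangle (rev_is_triangle (triangleP T))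
  end.

Definition bracket (R : realType) (rho : option R) : R :=
  if rho is Some r then Num.sqrt (1 - r + r ^+ 2) else 1.

Definition box (R : realType) (rho tau : option R) : option R :=
  match rho, tau with
  | Some r, Some t =>
      if r * t == 1 then None else Some ((r + t - r * t) / (1 - r * t))
  | Some r, None | None, Some r =>
      if r == 0 then None else Some (1 - 1 / r)
  | None, None => Some 1
  end.

Definition boxinv (R : realType) (tau : option R) : option R :=
  match tau with
  | Some t => if t == 1 then None else Some (t / (t - 1))
  | None => Some 1
  end.

(* Main.v *)
Require Import Defs.
From mathcomp Require Import all_boot all_order all_algebra.
From mathcomp Require Import ring lra.
From mathcomp Require Import reals.
Import Order.TTheory GRing.Theory Num.Theory.
Local Open Scope ring_scope.

(** On squared sides the operators are linear and become multiplication by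
    complex numbers.  Let w be a primitive cube root of unity, and encode the
    squared sides (A, B, C) by A + B w + C w^2 together with A + B + C, which
    determine them.  The matrix of the operator of parameter rho on squared
    sides is anti-circulant, so it conjugates A + B w + C w^2 and multiplies it
    by
      rho + (1 - rho) w + rho (rho - 1) w^2 = w u^2,  where u = 1 + rho w^2,
    while A + B + C is multiplied by |u|^2, the square of the bracket of rho.
    The parameter at infinity fits the same pattern with u = w^2.  Hence three
    operators with numbers u, v, t, applied in this order, amount to a single
    one: later conjugations hit the factor of v once and that of u twice, the
    factors w (1/w) w leave w, and the number of the composite is u v^* t, where
    v^* is the complex conjugate (lemma [ceva_sq_comp]).

    On the other hand rho |-> u identifies the extended line with the lines
    through 0 in the complex plane, and box and its inverse are the
    multiplication and the conjugation (equivalently, inversion) of those lines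
    ([homog_box], [homog_boxinv]).  So u v^* t = k s, where k is real and s is
    the number of the parameter of the single operator in the theorem.  A real
    factor k of the number multiplies all squared sides by k^2, hence all sides
    by |k|, and |k| is the announced ratio because the modulus is
    multiplicative.

    Below, the complex number q + p w^2 is the pair (p, q) of real numbers, so
    that a finite parameter rho is (rho, 1) and infinity is (1, 0). *)

Section Homogeneous.
Set Implicit Arguments.
Unset Strict Implicit.
Variable R : realType.
Implicit Types (u v t : R * R) (rho tau : option R).

Definition homog rho : R * R := if rho is Some r then (r, 1) else (1, 0).

(** Multiplication of the numbers q + p w^2, from w^4 = w = - 1 - w^2. *)
Definition hmul u v : R * R :=
  (u.1 * v.2 + u.2 * v.1 - u.1 * v.1, u.2 * v.2 - u.1 * v.1).

(** Complex conjugation: w^2 goes to w = - 1 - w^2. *)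
Definition hconj u : R * R := (- u.1, u.2 - u.1).

Definition hscale (k : R) u : R * R := (k * u.1, k * u.2).

(** The squared modulus of q + p w^2. *)
Definition hnorm u : R := u.1 ^+ 2 - u.1 * u.2 + u.2 ^+ 2.

Lemma hnormM u v : hnorm (hmul u v) = hnorm u * hnorm v.
Proof. by rewrite /hnorm /hmul /=; ring. Qed.

Lemma hnorm_conj u : hnorm (hconj u) = hnorm u.
Proof. by rewrite /hnorm /hconj /=; ring. Qed.

Lemma hnormZ k u : hnorm (hscale k u) = k ^+ 2 * hnorm u.
Proof. by rewrite /hnorm /hscale /=; ring. Qed.

Lemma hmulZl k u v : hmul (hscale k u) v = hscale k (hmul u v).
Proof. by rewrite /hmul /hscale /=; congr (_, _); ring. Qed.

Lemma hmulZr k u v : hmul u (hscale k v) = hscale k (hmul u v).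
Proof. by rewrite /hmul /hscale /=; congr (_, _); ring. Qed.

Lemma hscaleA k l u : hscale k (hscale l u) = hscale (k * l) u.
Proof. by rewrite /hscale /= !mulrA. Qed.

Lemma hnorm_homog_gt0 rho : 0 < hnorm (homog rho).
Proof. by case: rho => [r|]; rewrite /hnorm /=; nra. Qed.

Lemma bracketE rho : bracket rho = Num.sqrt (hnorm (homog rho)).
Proof.
case: rho => [r|]; rewrite /hnorm /=; first by congr Num.sqrt; ring.
by rewrite mulr0 subr0 expr0n addr0 expr1n sqrtr1.
Qed.

Lemma homog_box rho tau :
  exists k, hmul (homog rho) (homog tau) = hscale k (homog (box rho tau)).
Proof.
(* The scalar is read off the second coordinate of the product, or off the
   first one when the product is infinity. *)
case: rho tau => [r|] [t|] /=; rewrite /hmul /=.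
- case: eqP => [rt1|/eqP rt1] /=.
    by exists (r + t - r * t); rewrite /hscale /= rt1; congr (_, _); ring.
  have d0 : 1 - r * t != 0 by rewrite subr_eq0 eq_sym.
  by exists (1 - r * t); rewrite /hscale /=; congr (_, _); field.
- case: eqP => [->|/eqP r0] /=.
    by exists 1; rewrite /hscale /=; congr (_, _); ring.
  by exists (- r); rewrite /hscale /=; congr (_, _); field.
- case: eqP => [->|/eqP t0] /=.
    by exists 1; rewrite /hscale /=; congr (_, _); ring.
  by exists (- t); rewrite /hscale /=; congr (_, _); field.
- by exists (-1); rewrite /hscale /=; congr (_, _); ring.
Qed.

(** The conjugate of a nonzero complex number is a real multiple of its inverse,
    so up to scaling conjugation is inversion. *)
Lemma homog_boxinv tau :
  exists k, hconj (homog tau) = hscale k (homog (boxinv tau)).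
Proof.
case: tau => [t|] /=; rewrite /hconj /=; last first.
  by exists (-1); rewrite /hscale /=; congr (_, _); ring.
case: eqP => [->|/eqP t1] /=.
  by exists (-1); rewrite /hscale /=; congr (_, _); ring.
have d0 : t - 1 != 0 by rewrite subr_eq0.
by exists (1 - t); rewrite /hscale /=; congr (_, _); field.
Qed.

Definition sq_sides (T : triangle R) : R * R * R :=
  (side1 T ^+ 2, side2 T ^+ 2, side3 T ^+ 2).

(** The matrix of Ceva's operator, made homogeneous of degree 2 in the
    parameter p / q so that it also makes sense at infinity. *)
Definition ceva_sq u (s : R * R * R) : R * R * R :=
  let: (p, q) := u in let: (A, B, C) := s in
  (p * q * A + q * (q - p) * B + p * (p - q) * C,
   q * (q - p) * A + p * (p - q) * B + p * q * C,
   p * (p - q) * A + p * q * B + q * (q - p) * C).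

Lemma sq_sides_ceva rho T :
  sq_sides (ceva rho T) = ceva_sq (homog rho) (sq_sides T).
Proof.
case: rho => [r|] /=; rewrite /sq_sides /=; last by congr (_, _, _); ring.
have /and5P[x0 y0 z0 _ _] := ceva_is_triangle r (triangleP T).
rewrite !sqrtr_gt0 in x0 y0 z0.
rewrite !sqr_sqrtr ?ltW // /ceva_x2 /ceva_y2 /ceva_z2.
by congr (_, _, _); ring.
Qed.

(** Each operator conjugates the number A + B w + C w^2, so the middle one
    contributes the conjugate of its parameter. *)
Lemma ceva_sq_comp u v t s :
  ceva_sq t (ceva_sq v (ceva_sq u s)) = ceva_sq (hmul (hmul u (hconj v)) t) s.
Proof.
case: u v t s => [p q] [p' q'] [p'' q''] [[A B] C].
by rewrite /ceva_sq /hmul /hconj /=; congr (_, _, _); ring.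
Qed.

(** Sides are positive, so proportionality can be tested on squares. *)
Lemma similar_of_sq_sides T S (k : R) u s :
  sq_sides T = ceva_sq (hscale k u) s -> sq_sides S = ceva_sq u s ->
  directly_similar_with_ratio T S `|k|.
Proof.
case: u s => [p q] [[A B] C] [a2 b2 c2] [x2 y2 z2].
have /and5P[a0 b0 c0 _ _] := triangleP T.
have /and5P[x0 y0 z0 _ _] := triangleP S.
have ratioP (a x : R) : 0 < a -> 0 < x -> a ^+ 2 = k ^+ 2 * x ^+ 2 ->
    a / x = `|k|.
  move=> a_gt0 x_gt0 e; rewrite -(gtr0_norm a_gt0) -sqrtr_sqr e -exprMn.
  by rewrite sqrtr_sqr normrM (gtr0_norm x_gt0) mulfK ?gt_eqF.
by constructor 1; split; apply: ratioP => //;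
  rewrite ?a2 ?b2 ?c2 ?x2 ?y2 ?z2; ring.
Qed.

End Homogeneous.

Theorem lemma9p7 (R : realType) (rho tau zeta : option R) (T : triangle R)
    (hT : ~ equilateral T) :
  directly_similar_with_ratio
    (ceva zeta (ceva tau (ceva rho T)))
    (ceva (box (box rho (boxinv tau)) zeta) T)
    (bracket rho * bracket tau * bracket zeta
       / bracket (box (box rho (boxinv tau)) zeta)).
Proof.
set xi := box _ zeta.
have [k kE] : exists k,
    hmul (hmul (homog rho) (hconj (homog tau))) (homog zeta)
      = hscale k (homog xi).
  have [k1 ->] := homog_boxinv tau.
  have [k2 e2] := homog_box rho (boxinv tau).
  have [k3 e3] := homog_box (box rho (boxinv tau)) zeta.
  exists (k1 * k2 * k3).
  by rewrite hmulZr e2 !hmulZl e3 !hscaleA.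
have -> : bracket rho * bracket tau * bracket zeta / bracket xi = `|k|.
  have n_gt0 (sigma : option R) := hnorm_homog_gt0 sigma.
  have n_ge0 (sigma : option R) := ltW (n_gt0 sigma).
  rewrite !bracketE -!sqrtrM ?mulr_ge0 // -(hnorm_conj (homog tau)).
  rewrite -!hnormM kE hnormZ sqrtrM ?sqr_ge0 // sqrtr_sqr mulfK //.
  by rewrite gt_eqF // sqrtr_gt0.
apply: (similar_of_sq_sides (u := homog xi) (s := sq_sides T)).
  by rewrite !sq_sides_ceva ceva_sq_comp kE.
exact: sq_sides_ceva.
Qed.
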